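(* Let $C\subset\mathbb{P}^n$ be a binomial hypersurface of type $(t,\epsilon)$. Then $C^{\star t}=C$. Moreover, if $\gcd(t-1,\epsilon)=1$, then $t$ is the smallest integer $\geq 2$ for which this equality holds.
   Context: We work over $\mathbb{C}$. For points $p=[a_0:\cdots:a_n]$ and $q=[b_0:\cdots:b_n]$ of $\mathbb{P}^n$ with $a_ib_i\neq 0$ for some $i$, put $p\star q=[a_0b_0:\cdots:a_nb_n]$; if $a_ib_i=0$ for all $i$, then $p\star q$ is not defined. For varieties $V,W\subset\mathbb{P}^n$, the Hadamard product $V\star W$ is the Zariski closure of $\{p\star q: p\in V,\ q\in W,\ p\star q \text{ is defined}\}$. The Hadamard powers are $V^{\star 0}=\{[1:\cdots:1]\}$ and $V^{\star r}=V\star V^{\star(r-1)}$ for $r\ge 1$. For $I=(i_0,\dots,i_n)\in\mathbb{N}^{n+1}$, $X^I$ denotes the monomial $x_0^{i_0}\cdots x_n^{i_n}$. A binomial hypersurface is an irreducible hypersurface in $\mathbb{P}^n$ whose defining equation (generator of its homogeneous ideal) is of the form $\alpha_1X^{I_1}-\alpha_2X^{I_2}=0$, with $X^{I_1}\neq X^{I_2}$ of the same degree and $\alpha_1,\alpha_2\in\mathbb{C}$ nonzero. It is of type $(t,\epsilon)$, for integers $t\ge 2$ and $1\le\epsilon\le t-1$, if it has such an equation with $\alpha_1=1$ and $\alpha_2=\xi^{\epsilon}$, where $\xi$ is a primitive $(t-1)$-th root of unity. *)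

(* Defs.v *)
From mathcomp Require Import all_boot all_order all_algebra.
From mathcomp Require Import boolp classical_sets reals complex.
From mathcomp Require Import mpoly.

Set Implicit Arguments.
Unset Strict Implicit.
Unset Printing Implicit Defensive.

Import GRing.Theory.
Local Open Scope ring_scope.
Local Open Scope classical_set_scope.
Local Open Scope quotient_scope.

Section ProjectiveSpace.
Variables (F : fieldType) (n : nat).

Definition nzvec : choiceType := {v : 'rV[F]_n.+1 | v != 0}.

Definition proportional (v w : nzvec) : bool :=
  `[< exists k : F, val w = k *: val v >].

Lemma proportional_refl : reflexive proportional.
Proof. by move=> v; apply/asboolP; exists 1; rewrite scale1r. Qed.

Lemma proportional_sym : ssrbool.symmetric proportional.
Proof.
suff H v w : proportional v w -> proportional w v.
  by move=> v w; apply/idP/idP; apply: H.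
move=> /asboolP[k wE]; apply/asboolP; exists k^-1.
have k0 : k != 0.
  by apply: contraNneq (valP w) => k0; rewrite wE k0 scale0r.
by rewrite wE scalerA mulVf // scale1r.
Qed.

Lemma proportional_trans : transitive proportional.
Proof.
move=> w v u /asboolP[k wE] /asboolP[l uE]; apply/asboolP.
by exists (l * k); rewrite uE wE scalerA.
Qed.

Canonical proportional_equiv :=
  EquivRel proportional proportional_refl proportional_sym proportional_trans.

Definition projspace : Type := {eq_quot proportional_equiv}.

Definition proj_point (v : 'rV[F]_n.+1) (v0 : v != 0) : projspace :=
  \pi_({eq_quot proportional_equiv}) (exist _ v v0).

(* [coords p v]: p = [v_0 : ... : v_n]; in particular v is nonzero. *)
Definition coords (p : projspace) (v : 'rV[F]_n.+1) : Prop :=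
  exists v0 : v != 0, p = proj_point v0.

Definition vanishes_at (f : {mpoly F[n.+1]}) (p : projspace) : Prop :=
  forall v, coords p v -> f.@[v 0] = 0.

Definition zero_locus (S : set {mpoly F[n.+1]}) : set projspace :=
  [set p | forall f, S f -> vanishes_at f p].

Definition homogeneous (f : {mpoly F[n.+1]}) : Prop :=
  exists d : nat, f \is d.-homog.

Definition zariski_closed (V : set projspace) : Prop :=
  exists2 S, S `<=` homogeneous & V = zero_locus S.

Definition zariski_closure (A : set projspace) : set projspace :=
  smallest zariski_closed A.

Definition zariski_irreducible (V : set projspace) : Prop :=
  V !=set0 /\
  forall A B, zariski_closed A -> zariski_closed B ->
    V `<=` A `|` B -> V `<=` A \/ V `<=` B.

(* As vanishes_at ranges over all homogeneous coordinates of a point, over an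
   infinite field this is the ideal generated by the homogeneous polynomials
   that vanish on V. *)
Definition homogeneous_ideal (V : set projspace) : set {mpoly F[n.+1]} :=
  [set f | forall p, V p -> vanishes_at f p].

Definition hypersurface (V : set projspace) : Prop :=
  exists (d : nat) (f : {mpoly F[n.+1]}),
    [/\ (0 < d)%N, f \is d.-homog, f != 0 & V = zero_locus [set f]].

Definition defining_equation (V : set projspace) (f : {mpoly F[n.+1]}) : Prop :=
  homogeneous_ideal V = [set g | exists h, g = h * f].

Definition has_binomial_equation (V : set projspace) (a1 a2 : F) : Prop :=
  exists I1 I2 : 'X_{1..n.+1},
    [/\ I1 != I2, mdeg I1 = mdeg I2 &
        defining_equation V (a1 *: 'X_[I1] - a2 *: 'X_[I2])].

Definition binomial_hypersurface (V : set projspace) : Prop :=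
  [/\ hypersurface V, zariski_irreducible V &
      exists a1 a2 : F,
        [/\ a1 != 0, a2 != 0 & has_binomial_equation V a1 a2]].

Definition binomial_hypersurface_of_type (t e : nat) (V : set projspace) : Prop :=
  [/\ binomial_hypersurface V, (2 <= t)%N, (1 <= e <= t - 1)%N &
      exists xi : F,
        (t - 1).-primitive_root xi /\ has_binomial_equation V 1 (xi ^+ e)].

(* [star p q r]: the Hadamard product of p and q is defined and equal to r. *)
Definition star (p q r : projspace) : Prop :=
  exists v w, [/\ coords p v, coords q w & coords r (\row_i (v 0 i * w 0 i))].

Definition hadamard (V W : set projspace) : set projspace :=
  zariski_closure [set r | exists p q, [/\ V p, W q & star p q r]].

Lemma ones_neq0 : const_mx 1 != 0 :> 'rV[F]_n.+1.
Proof. by apply/eqP => /rowP/(_ ord0)/eqP; rewrite !mxE oner_eq0. Qed.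

Fixpoint hadamard_pow (V : set projspace) (r : nat) : set projspace :=
  if r is r'.+1 then hadamard V (hadamard_pow V r')
  else [set proj_point ones_neq0].

End ProjectiveSpace.

(* Main.v *)
Require Import Defs.
From mathcomp Require Import all_boot all_order all_algebra.
From mathcomp Require Import boolp classical_sets reals complex.
From mathcomp Require Import mpoly.

(** Let [T] be the set of points with no zero coordinate and let [D a] be the
    hypersurface [X^I1 = a X^I2].  Write [C = D a].  Evaluation of monomials is
    multiplicative, so [C^{*r}] is contained in [D (a ^ r)], and it contains
    [D (a ^ r)] intersected with [T] for [r >= 1], as one can divide by a fixed
    point of [C] in [T].  An irreducible [C] meeting [T] is contained in every
    closed set containing its intersection with [T], so [a ^ t = a] gives
    [C^{*t} = C].  Conversely [C^{*s} = C] forces [D (a ^ s)] and [D a] to share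
    a point of [T], hence [a ^ (s - 1) = 1]. *)

Section Evaluation.
Set Implicit Arguments.
Unset Strict Implicit.
Unset Printing Implicit Defensive.
Import GRing.Theory.
Local Open Scope ring_scope.
Local Open Scope classical_set_scope.
Local Open Scope quotient_scope.

Lemma meval_dhomogZ (F : fieldType) (m d : nat) (f : {mpoly F[m]}) (k : F)
    (u v : 'I_m -> F) :
  f \is d.-homog -> (forall i, u i = k * v i) -> f.@[u] = k ^+ d * f.@[v].
Proof.
move=> /dhomogP fd uE; rewrite !mevalE big_distrr /=; apply: eq_big_seq => J Jf.
rewrite mulrCA -(fd J Jf) /= mdegE -prodrXr -big_split /=; congr (_ * _).
by apply: eq_bigr => i _; rewrite uE exprMn.
Qed.

Lemma exists_root_exp (F : closedFieldType) (k : nat) (a : F) :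
  (0 < k)%N -> exists x, x ^+ k = a.
Proof.
case: k => // k _.
(* [solve_monicpoly] solves [x ^+ k.+1 = \sum_i c i * x ^+ i]; only the constant coefficient is
   kept. *)
have [x xE] := @solve_monicpoly F k.+1 (fun i => if i == 0%N then a else 0) isT.
exists x; rewrite xE big_ord_recl /= expr0 mulr1 big1 ?addr0 // => i _.
by rewrite mul0r.
Qed.

(** * Homogeneous coordinates and evaluation of monomials *)

Section ProjectivePoints.
Variables (F : fieldType) (n : nat).
Implicit Types (p q r : projspace F n) (v w : 'rV[F]_n.+1) (m : 'X_{1..n.+1}).

Lemma coords_inj p q v : coords p v -> coords q v -> p = q.
Proof.
move=> [v0 ->] [v1 ->]; rewrite /proj_point.
by congr (\pi_({eq_quot _}) (exist _ _ _)); apply: bool_irrelevance.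
Qed.

Lemma coords_proportional p v w :
  coords p v -> coords p w -> exists k, w = k *: v.
Proof.
move=> [v0 ->] [w0 pE].
have /eqmodP/asboolP[k wE] :
  \pi_({eq_quot proportional_equiv F n}) (exist _ v v0)
    = \pi_({eq_quot proportional_equiv F n}) (exist _ w w0) by [].
by exists k.
Qed.

Lemma coords_exists p : exists v, coords p v.
Proof.
case E: (repr p) => [v v0]; exists v, v0.
by rewrite /proj_point -E reprK.
Qed.

(** Rescaling the coordinates by [k] multiplies the value of [f] by [k ^+ d], so a single choice of
    coordinates decides vanishing. *)
Lemma vanishes_at_coords d (f : {mpoly F[n.+1]}) p v :
  f \is d.-homog -> coords p v -> f.@[v 0] = 0 -> vanishes_at f p.
Proof.
move=> fd pv fv w pw; have [k wE] := coords_proportional pv pw.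
by rewrite (@meval_dhomogZ _ _ d f k (w 0) (v 0)) ?fv ?mulr0 // => i; rewrite wE mxE.
Qed.

Lemma zariski_closed_locus1 d (f : {mpoly F[n.+1]}) :
  f \is d.-homog -> zariski_closed (zero_locus [set f]).
Proof. by move=> fd; exists [set f] => // g ->; exists d. Qed.

Lemma row_mulrDiv v w :
  (forall i, w 0 i != 0) -> \row_i (w 0 i * (\row_j (v 0 j / w 0 j)) 0 i) = v.
Proof. by move=> w0; apply/rowP => i; rewrite !mxE mulrC divfK. Qed.

Lemma torus_neq0 v : (forall i, v 0 i != 0) -> v != 0.
Proof. by move=> /(_ ord0); apply: contraNneq => ->; rewrite mxE. Qed.

Lemma mevalX_mul m v w :
  'X_[m].@[(\row_i (v 0 i * w 0 i)) 0] = 'X_[m].@[v 0] * 'X_[m].@[w 0].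
Proof.
rewrite !mevalX -big_split /=; apply: eq_bigr => i _.
by rewrite mxE exprMn.
Qed.

Lemma mevalX_ones m : 'X_[m].@[(const_mx 1 : 'rV[F]_n.+1) 0] = 1.
Proof. by rewrite mevalX big1 // => i _; rewrite mxE expr1n. Qed.

Lemma mevalX_neq0 m v : (forall i, v 0 i != 0) -> 'X_[m].@[v 0] != 0.
Proof.
by move=> v0; rewrite mevalX; apply/prodf_neq0 => i _; apply: expf_neq0.
Qed.

Lemma irreducible_sub_torus_closed (V B : set (projspace F n)) p v :
  zariski_irreducible V -> V p -> coords p v -> (forall i, v 0 i != 0) ->
  zariski_closed B ->
  (forall q w, V q -> coords q w -> (forall i, w 0 i != 0) -> B q) -> V `<=` B.
Proof.
move=> [_ Virr] Vp pv v0 Bcl VB.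
(* ['X_[m]] is the product of all variables: its zero locus is the union of the coordinate
   hyperplanes. With [B] it covers [V], and [p] rules out that it contains [V]. *)
pose m : 'X_{1..n.+1} := [multinom 1%N | i < n.+1].
have md : 'X_[F, m] \is (mdeg m).-homog by rewrite dhomogX.
case: (Virr B (zero_locus [set 'X_[F, m]]) Bcl (zariski_closed_locus1 md)) => //.
  move=> q Vq; have [w qw] := coords_exists q.
  have [w0|] := pselect (forall i, w 0 i != 0); first by left; apply: VB qw w0.
  move=> /existsNP[i /negP/negPn/eqP wi0]; right => _ ->.
  apply: (vanishes_at_coords md qw).
  by rewrite mevalX (bigD1 i) //= wi0 mnmE expr1 mul0r.
by move=> /(_ _ Vp _ erefl _ pv)/eqP; rewrite (negPf (mevalX_neq0 m v0)).
Qed.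

(** * Hadamard powers of binomial loci *)

Section Binomial.
Variables I1 I2 : 'X_{1..n.+1}.
Hypothesis I12_deg : mdeg I1 = mdeg I2.

Definition binomial_locus (a : F) : set (projspace F n) :=
  zero_locus [set 1 *: 'X_[I1] - a *: 'X_[I2]].

Lemma binomial_dhomog (a : F) :
  1 *: 'X_[I1] - a *: 'X_[I2] \is (mdeg I1).-homog.
Proof. by rewrite rpredB // dhomogZ // dhomogX // I12_deg. Qed.

Lemma binomial_locusP a p v :
  coords p v ->
  binomial_locus a p <-> 'X_[I1].@[v 0] = a * 'X_[I2].@[v 0].
Proof.
move=> pv; split=> [/(_ _ erefl v pv)|pE].
  by rewrite mevalB !mevalZ mul1r => /eqP; rewrite subr_eq0 => /eqP.
move=> _ ->; apply: vanishes_at_coords (binomial_dhomog a) pv _.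
by rewrite mevalB !mevalZ mul1r pE subrr.
Qed.

(** Each factor taken from [V] multiplies the constant by [a], and the closure stays inside because
    a binomial locus is closed. *)
Lemma hadamard_pow_sub_locus (V : set (projspace F n)) a k :
  V `<=` binomial_locus a -> hadamard_pow V k `<=` binomial_locus (a ^+ k).
Proof.
move=> Va; elim: k => [|k IHk] /=.
  move=> _ ->; have pv : coords (proj_point (ones_neq0 F n)) (const_mx 1).
    by exists (ones_neq0 F n).
  by apply/(binomial_locusP _ pv); rewrite !mevalX_ones expr0 mul1r.
apply: smallest_sub; first exact: zariski_closed_locus1 (binomial_dhomog _).
move=> r [p [q [Vp Vq [v [w [pv qw rvw]]]]]].
apply/(binomial_locusP _ rvw); rewrite !mevalX_mul.
rewrite ((binomial_locusP _ pv).1 (Va _ Vp)) ((binomial_locusP _ qw).1 (IHk _ Vq)).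
by rewrite exprS mulrACA.
Qed.

(** Induction on [k]: write [q] as the product of [p] and the coordinatewise quotient [q / p], whose
    constant has one factor [a] fewer. The base case multiplies [q] by [[1 : ... : 1]]. *)
Lemma torus_locus_sub_hadamard_pow a k p v q w :
  binomial_locus a p -> coords p v -> (forall i, v 0 i != 0) ->
  binomial_locus (a ^+ k.+1) q -> coords q w -> (forall i, w 0 i != 0) ->
  hadamard_pow (binomial_locus a) k.+1 q.
Proof.
move=> ap pv v0; elim: k q w => [|k IHk] q w aq qw w0.
  apply: sub_gen_smallest; exists q, (proj_point (ones_neq0 F n)); split => //.
  exists w, (const_mx 1); split => //; first by exists (ones_neq0 F n).
  by have -> : \row_i (w 0 i * (const_mx 1 : 'rV_n.+1) 0 i) = w
    by apply/rowP => i; rewrite !mxE mulr1.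
pose u := \row_i (w 0 i / v 0 i).
have uE : \row_i (v 0 i * u 0 i) = w by apply: row_mulrDiv.
have u0 i : u 0 i != 0 by rewrite mxE mulf_neq0 ?invr_eq0.
have su : coords (proj_point (torus_neq0 u0)) u by exists (torus_neq0 u0).
apply: sub_gen_smallest; exists p, (proj_point (torus_neq0 u0)); split => //.
  apply: (IHk _ u) => //; apply/(binomial_locusP _ su).
  have := (binomial_locusP _ qw).1 aq; rewrite -uE !mevalX_mul.
  (* Both sides share the factor [a * 'X_[I2].@[v 0]]. It equals ['X_[I1].@[v 0]], hence is nonzero
     and cancels. *)
  rewrite ((binomial_locusP _ pv).1 ap) exprS mulrACA => /mulfI; apply.
  apply: contraNneq (mevalX_neq0 I1 v0) => a0.
  by rewrite ((binomial_locusP _ pv).1 ap) a0.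
by exists v, u; rewrite uE.
Qed.

End Binomial.
End ProjectivePoints.

(** Put 1 at every index except one [i0] where the exponents differ; there remains an equation in
    one unknown, solvable by extracting a root of [a] or of its inverse. *)
Lemma binomial_locus_torus (F : closedFieldType) (n : nat)
    (I1 I2 : 'X_{1..n.+1}) (a : F) :
  I1 != I2 -> a != 0 ->
  exists2 v : 'rV[F]_n.+1, forall i, v 0 i != 0
    & 'X_[I1].@[v 0] = a * 'X_[I2].@[v 0].
Proof.
move=> I12 a0.
have [i0 Ii0] : exists i, I1 i != I2 i.
  by apply/existsP; apply: contraNT I12 => /existsPn I12;
     apply/eqP/mnmP => i; apply/eqP/negPn/I12.
have [x x0 xE] : exists2 x : F, x != 0 & x ^+ I1 i0 = a * x ^+ I2 i0.
  have nz (k : nat) (x b : F) : (0 < k)%N -> b != 0 -> x ^+ k = b -> x != 0.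
    by move=> k0 b0 xb; apply: contraNneq b0 => x0; rewrite -xb x0 expr0n gtn_eqF.
  case: (ltngtP (I1 i0) (I2 i0)) Ii0 => // lt12 _; last first.
    have k0 : (0 < I1 i0 - I2 i0)%N by rewrite subn_gt0.
    have [x xE] := @exists_root_exp F _ a k0.
    by exists x; [apply: nz xE | rewrite -xE -exprD subnK // ltnW].
  have k0 : (0 < I2 i0 - I1 i0)%N by rewrite subn_gt0.
  have [x xE] := @exists_root_exp F _ a^-1 k0.
  exists x; first by apply: nz xE; rewrite ?invr_eq0.
  by rewrite -(subnK (ltnW lt12)) exprD xE mulVKf.
exists (\row_i if i == i0 then x else 1) => [i|].
  by rewrite mxE; case: ifP; rewrite ?oner_eq0.
have E m : 'X_[m].@[(\row_i if i == i0 then x else 1) 0] = x ^+ m i0.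
  rewrite mevalX (bigD1 i0) //= mxE eqxx big1 ?mulr1 // => i /negPf ii0.
  by rewrite mxE ii0 expr1n.
by rewrite !E.
Qed.

(** If [g] cuts out [V], then [g] lies in the ideal of [V] and so is a multiple of [f]: zeros of [f]
    are zeros of [g]. *)
Lemma defining_equation_hypersurface (F : fieldType) (n : nat)
    (V : set (projspace F n)) (f : {mpoly F[n.+1]}) :
  hypersurface V -> defining_equation V f -> V = zero_locus [set f].
Proof.
move=> [d [g [_ _ _ VE]]] fV; apply/seteqP; split=> p Vp.
  move=> _ ->; suff : homogeneous_ideal V f by apply.
  by rewrite fV; exists 1; rewrite mul1r.
have : homogeneous_ideal V g by move=> q; rewrite VE; apply.
rewrite fV => -[h gE]; rewrite VE => _ -> v pv.
by rewrite gE mevalM (Vp _ erefl _ pv) mulr0.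
Qed.

(** For [a = xi ^+ e], the case [k = t] yields the equality and the case [k = s] the minimality of
    [t]. *)
Lemma hadamard_pow_binomial (F : closedFieldType) (n : nat)
    (I1 I2 : 'X_{1..n.+1}) (a : F) (k : nat) :
  mdeg I1 = mdeg I2 -> I1 != I2 -> a != 0 -> (0 < k)%N ->
  zariski_irreducible (@binomial_locus F n I1 I2 a) ->
  hadamard_pow (binomial_locus I1 I2 a) k = binomial_locus I1 I2 a
  <-> a ^+ (k - 1) = 1.
Proof.
move=> I12d I12 a0; case: k => // k _; rewrite subSS subn0 => Cirr.
split=> [CE|ak].
  have [v v0 vE] := @binomial_locus_torus F n I1 I2 (a ^+ k.+1) I12 (expf_neq0 _ a0).
  have [w w0 wE] := @binomial_locus_torus F n I1 I2 a I12 a0.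
  have pv : coords (proj_point (torus_neq0 v0)) v by exists (torus_neq0 v0).
  have qw : coords (proj_point (torus_neq0 w0)) w by exists (torus_neq0 w0).
  have := torus_locus_sub_hadamard_pow I12d ((binomial_locusP I12d a qw).2 wE) qw w0
    ((binomial_locusP I12d _ pv).2 vE) pv v0.
  rewrite CE => /(binomial_locusP I12d _ pv); rewrite vE.
  move=> /mulIf -/(_ (mevalX_neq0 _ v0)); rewrite exprS -[RHS]mulr1.
  exact: mulfI.
have akS : a ^+ k.+1 = a by rewrite exprS ak mulr1.
apply/seteqP; split.
  by rewrite -[X in _ `<=` binomial_locus _ _ X]akS; apply: hadamard_pow_sub_locus.
have [w w0 wE] := @binomial_locus_torus F n I1 I2 a I12 a0.
have qw : coords (proj_point (torus_neq0 w0)) w by exists (torus_neq0 w0).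
have aq := (binomial_locusP I12d a qw).2 wE.
(* A positive Hadamard power is by definition a closure, so membership is tested against each closed
   [B] containing the products. *)
move=> p ap B [Bcl AB].
apply: (irreducible_sub_torus_closed Cirr aq qw w0 Bcl) ap => r u ar ru u0.
have := torus_locus_sub_hadamard_pow I12d aq qw w0 (k := k) _ ru u0.
by rewrite akS => /(_ ar) /(_ B); apply; split.
Qed.

End Evaluation.

Theorem proposition5p3 (R : realType) (n t e : nat)
  (C : set (projspace R[i] n))
  (C_type : binomial_hypersurface_of_type t e C) :
  hadamard_pow C t = C /\
  (gcdn (t - 1) e = 1%N ->
   forall s : nat, (2 <= s)%N -> hadamard_pow C s = C -> (t <= s)%N).
Proof.
case: C_type => [[Chyp Cirr _] t2 _ [xi [xi_prim [I1 [I2 [I12 I12d Ceq]]]]]].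
have xi0 : (xi != 0)%R by rewrite (prim_root_eq0 xi_prim) -lt0n subn_gt0.
have CE := defining_equation_hypersurface Chyp Ceq.
rewrite -/(binomial_locus I1 I2 (xi ^+ e)%R) in CE; rewrite CE in Cirr *.
have a0 : (xi ^+ e != 0)%R by rewrite GRing.expf_neq0.
split=> [|te1 s s2].
  apply/(hadamard_pow_binomial I12d I12 a0 (ltnW t2) Cirr).
  by rewrite -GRing.exprM mulnC GRing.exprM (prim_expr_order xi_prim) GRing.expr1n.
move=> /(hadamard_pow_binomial I12d I12 a0 (ltnW s2) Cirr)/eqP.
(* [t - 1] divides [e * (s - 1)] and is coprime to [e], so it divides [s - 1], which is positive. *)
rewrite -GRing.exprM -(prim_order_dvd xi_prim) Gauss_dvdr; last exact/eqP.
by move=> /dvdn_leq; rewrite subn_gt0 s2 leq_sub2rE ?(ltnW s2) //; apply.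
Qed.
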